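(* Let $\mathscr{A}$ be a category with finite limits and a projective class $\mathscr{P}$, $\mathscr{B}$ an abelian category, and $T:\mathscr{A}\to\mathscr{B}$ an arbitrary (covariant) functor. Let $L_n^{\square}T$ and $\widetilde L_n^{\square}T:\mathscr{A}\to\mathscr{B}$, $n\ge0$, be the cubical left derived functors of $T$ given by $L_n^{\square}T(A)=H_n(N(T(P)))$ and $\widetilde L_n^{\square}T(A)=H_n(M(T(P)))$, where $P\to A$ is a $\mathscr{P}$-projective precubical resolution of $A$. Then there are isomorphisms $$L_n^{\square}T(A)\cong\widetilde L_n^{\square}T(A),\quad n\ge0,$$ which are natural in $A$ and in $T$.
   Context: A precubical object $X$ in a category is a family of objects $(X_n)_{n\ge 0}$ with face morphisms $\partial_i^0,\partial_i^1: X_n\to X_{n-1}$ ($1\le i\le n$) satisfying $\partial_i^\alpha\partial_j^\varepsilon=\partial_{j-1}^\varepsilon\partial_i^\alpha$ for $i<j$, $\alpha,\varepsilon\in\{0,1\}$. An augmented precubical object $X\xrightarrow{\partial}A$ is a precubical object $X$ with an object $A$ and a morphism $\partial: X_0\to A$ such that $\partial\partial_1^0=\partial\partial_1^1$. Given a class $\mathscr{P}$ of objects of $\mathscr{A}$, a morphism $f: B\to B'$ is $\mathscr{P}$-epimorphic if $\mathrm{Hom}_{\mathscr{A}}(Q,f)$ is surjective for all $Q\in\mathscr{P}$. $\mathscr{P}$ is a projective class if for each object $B$ there is a $\mathscr{P}$-epimorphic $e: Q\to B$ with $Q\in\mathscr{P}$. A cubical kernel of a sequence of morphisms $f_1^0,\dots,f_n^0,f_1^1,\dots,f_n^1: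 B\to C$ ($n\ge1$) is a sequence $k_1^0,\dots,k_{n+1}^0,k_1^1,\dots,k_{n+1}^1: K\to B$ with $f_i^\omega k_j^\alpha=f_{j-1}^\alpha k_i^\omega$ for $1\le i<j\le n+1$, $\omega,\alpha\in\{0,1\}$, which is universal: for any sequence $h_1^0,\dots,h_{n+1}^0,h_1^1,\dots,h_{n+1}^1: D\to B$ satisfying the same identities there is a unique $h: D\to K$ with $k_i^\omega h=h_i^\omega$ for all $i,\omega$. For an augmented precubical object $X\xrightarrow{\partial}A$ in $\mathscr{A}$, let $k_1^0,k_1^1: K_1\to X_0$ be the kernel pair of $\partial$ and, for $n\ge2$, let $k_1^0,\dots,k_n^0,k_1^1,\dots,k_n^1: K_n\to X_{n-1}$ be a cubical kernel of the faces $(\partial_1^0,\dots,\partial_{n-1}^0,\partial_1^1,\dots,\partial_{n-1}^1): X_{n-1}\to X_{n-2}$. Let $e_n: X_n\to K_n$ be the unique morphism with $k_i^\varepsilon e_n=\partial_i^\varepsilon$. Then $X\xrightarrow{\partial}A$ is a $\mathscr{P}$-projective precubical resolution of $A$ if every $X_n\in\mathscr{P}$ ($n\ge0$) and $\partial$ and all $e_n$ ($n\ge1$) are $\mathscr{P}$-epimorphic. Every object $A$ has such a resolution. For a precubical object $X$ in an abelian category: $N(X)$ is the chain complex with $N_0(X)=X_0$, $N_n(X)=\bigcap_{i=1}^n\ker\partial_i^1$ ($n>0$) and differential $\sum_{i=1}^n(-1)^{i+1}\partial_i^0$; $M(X)$ is the subcomplex with $M_0(X)=X_0$, $M_n(X)=\left(\bigcap_{i=1}^n\ker\partial_i^1\right)\cap\left(\bigcap_{i=1}^{n-1}\ker\partial_i^0\right)$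 ($n>0$) and differential $(-1)^{n+1}\partial_n^0$. For each $A\in\mathscr{A}$ one chooses once and for all a $\mathscr{P}$-projective precubical resolution $P\to A$; $T(P)$ is the precubical object in $\mathscr{B}$ obtained by applying $T$ degreewise. On a morphism $f: A\to A'$, $L_n^{\square}T(f)$ and $\widetilde L_n^{\square}T(f)$ are induced by any precubical morphism $\overline f=(f_n): P\to P'$ of the chosen resolutions extending $f$ (i.e. with $f\partial=\partial'f_0$). The resulting functors are well defined, independent of the choices up to natural isomorphism, and functorial in $T$. *)

(* Defs.v *)
From HB Require Import structures.
From mathcomp Require Import all_boot ssralg.
From mathcomp Require Import boolp classical_sets cardinality.

Set Implicit Arguments.
Unset Strict Implicit.
Unset Printing Implicit Defensive.

Import GRing.Theory.
Local Open Scope ring_scope.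
Local Obligation Tactic := idtac.

(** * Categories, functors, natural transformations *)

Record category := Category {
  Ob :> Type;
  Hom : Ob -> Ob -> Type;
  idc : forall X, Hom X X;
  compc : forall X Y Z, Hom Y Z -> Hom X Y -> Hom X Z;
  compcA : forall X Y Z W (h : Hom Z W) (g : Hom Y Z) (f : Hom X Y),
    compc h (compc g f) = compc (compc h g) f;
  comp1c : forall X Y (f : Hom X Y), compc (idc Y) f = f;
  compc1 : forall X Y (f : Hom X Y), compc f (idc X) = f
}.
Arguments Hom {c} X Y : rename.
Arguments idc {c} X : rename.
Arguments compc {c X Y Z} g f : rename.

Notation "g ∘ f" := (compc g f) (at level 40, left associativity).

Record functor (C D : category) := Functor {
  fob :> C -> D;
  fmor : forall X Y, Hom X Y -> Hom (fob X) (fob Y);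
  fmor1 : forall X, fmor (idc X) = idc (fob X);
  fmorM : forall X Y Z (g : Hom Y Z) (f : Hom X Y),
    fmor (g ∘ f) = fmor g ∘ fmor f
}.
Arguments fmor {C D} T {X Y} f : rename.

Record nat_trans (C D : category) (S T : functor C D) := NatTrans {
  ntc :> forall X, Hom (S X) (T X);
  ntcE : forall X Y (f : Hom X Y), ntc Y ∘ fmor S f = fmor T f ∘ ntc X
}.

Program Definition functor_comp (C D E : category)
    (G : functor D E) (F : functor C D) : functor C E :=
  @Functor C E (fun X => G (F X)) (fun X Y f => fmor G (fmor F f)) _ _.
Next Obligation. by move=> * /=; rewrite !fmor1. Qed.
Next Obligation. by move=> * /=; rewrite !fmorM. Qed.

Section CategoryNotions.
Variable C : category.

Definition mono (X Y : C) (f : Hom X Y) :=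
  forall D (g h : Hom D X), f ∘ g = f ∘ h -> g = h.

Definition epi (X Y : C) (f : Hom X Y) :=
  forall D (g h : Hom Y D), g ∘ f = h ∘ f -> g = h.

Definition is_iso (X Y : C) (f : Hom X Y) :=
  exists g : Hom Y X, g ∘ f = idc X /\ f ∘ g = idc Y.

Definition is_initial (I : C) := forall X, exists! f : Hom I X, True.
Definition is_terminal (I : C) := forall X, exists! f : Hom X I, True.

Definition is_limit (J : category) (D : functor J C) (L : C)
    (p : forall j, Hom L (D j)) :=
  (forall i j (u : Hom i j), fmor D u ∘ p i = p j) /\
  (forall (M : C) (q : forall j, Hom M (D j)),
     (forall i j (u : Hom i j), fmor D u ∘ q i = q j) ->
     exists! h : Hom M L, forall j, p j ∘ h = q j).

Definition finite_category (J : category) :=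
  finite_set [set: Ob J] /\ forall i j : J, finite_set [set: Hom i j].

Definition has_finite_limits :=
  forall (J : category) (D : functor J C), finite_category J ->
  exists (L : C) (p : forall j, Hom L (D j)), is_limit p.

Definition is_kernel_pair (X Y K : C) (f : Hom X Y) (k0 k1 : Hom K X) :=
  f ∘ k0 = f ∘ k1 /\
  forall (D : C) (h0 h1 : Hom D X), f ∘ h0 = f ∘ h1 ->
    exists! h : Hom D K, k0 ∘ h = h0 /\ k1 ∘ h = h1.

(** * Projective classes *)

Section ProjectiveClass.
Variable P : C -> Prop.

Definition epimorphic (X Y : C) (f : Hom X Y) :=
  forall Q, P Q -> forall g : Hom Q Y, exists h : Hom Q X, f ∘ h = g.

Definition projective_class :=
  forall X : C, exists (Q : C) (e : Hom Q X), P Q /\ epimorphic e.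
End ProjectiveClass.

(** * Precubical objects

    A family of morphisms [f_1^0, ..., f_n^0, f_1^1, ..., f_n^1] is encoded as
    [f : bool -> 'I_n -> Hom _ _], the superscript 0 (resp. 1) being [false]
    (resp. [true]) and the lower indices being shifted to start from 0. *)

(* [f_i^w h_j^a = f_{j-1}^a h_i^w] for [i < j]; here the ordinal [j] stands
   for the lower index [j - 1], so that [lift ord0 j] is its successor. *)
Definition cubical_identities n (X Y Z : C)
    (f : bool -> 'I_n -> Hom Y Z) (h : bool -> 'I_n.+1 -> Hom X Y) :=
  forall (w a : bool) (i j : 'I_n), (i <= j)%N ->
    f w i ∘ h a (lift ord0 j) = f a j ∘ h w (widen_ord (leqnSn n) i).

Definition is_cubical_kernel n (X Y K : C)
    (f : bool -> 'I_n -> Hom X Y) (k : bool -> 'I_n.+1 -> Hom K X) :=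
  cubical_identities f k /\
  forall (D : C) (h : bool -> 'I_n.+1 -> Hom D X), cubical_identities f h ->
    exists! u : Hom D K, forall a i, k a i ∘ u = h a i.

Record precubical := Precubical {
  pob :> nat -> C;
  face : forall n, bool -> 'I_n.+1 -> Hom (pob n.+1) (pob n);
  faceE : forall n, cubical_identities (@face n) (@face n.+1)
}.

Record precubical_mor (X Y : precubical) := PrecubicalMor {
  pmor :> forall n, Hom (X n) (Y n);
  pmor_face : forall n a (i : 'I_n.+1),
    face Y a i ∘ pmor n.+1 = pmor n ∘ face X a i
}.

Lemma precubical_mor_eq X Y (f g : precubical_mor X Y) :
  (forall n, f n = g n) -> f = g.
Proof.
case: f g => [f fE] [g gE] /= fg.
have {}fg : f = g by apply: functional_extensionality_dep.
by case: _ / fg gE => gE; rewrite (Prop_irrelevance fE gE).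
Qed.

Program Definition precubical_id X : precubical_mor X X :=
  @PrecubicalMor X X (fun n => idc (X n)) _.
Next Obligation. by move=> *; rewrite comp1c compc1. Qed.

Program Definition precubical_comp X Y Z
    (g : precubical_mor Y Z) (f : precubical_mor X Y) : precubical_mor X Z :=
  @PrecubicalMor X Z (fun n => g n ∘ f n) _.
Next Obligation.
by move=> X Y Z g f n a i; rewrite compcA pmor_face -!compcA pmor_face.
Qed.

Program Definition precub : category :=
  @Category precubical precubical_mor precubical_id precubical_comp _ _ _.
Next Obligation.
by move=> *; apply: precubical_mor_eq => n /=; rewrite compcA.
Qed.
Next Obligation. by move=> *; apply: precubical_mor_eq => n /=; rewrite comp1c. Qed.
Next Obligation. by move=> *; apply: precubical_mor_eq => n /=; rewrite compc1. Qed.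

Record augmented (A : C) := Augmented {
  aug_ob :> precubical;
  aug : Hom (aug_ob 0%N) A;
  augE : aug ∘ face aug_ob false ord0 = aug ∘ face aug_ob true ord0
}.

(** * Projective precubical resolutions *)

(* The objects [K] are the [K_1] and [K_{n+2}] of the definition. They are
   only determined up to isomorphism, on which the condition on [e] does not
   depend. *)
Definition is_resolution (P : C -> Prop) (A : C) (X : augmented A) :=
  [/\ forall n, P (X n),
      epimorphic P (aug X),
      exists (K : C) (k : bool -> Hom K (X 0%N)) (e : Hom (X 1%N) K),
        [/\ is_kernel_pair (aug X) (k false) (k true),
            forall a, k a ∘ e = face X a ord0
          & epimorphic P e]
    & forall n,
      exists (K : C) (k : bool -> 'I_n.+2 -> Hom K (X n.+1))
             (e : Hom (X n.+2) K),
        [/\ is_cubical_kernel (face X (n := n)) k,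
            forall a i, k a i ∘ e = face X a i
          & epimorphic P e]].

Record resolution (P : C -> Prop) (A : C) := Resolution {
  res_aug :> augmented A;
  resP : is_resolution P res_aug
}.

Definition extends (A A' : C) (X : augmented A) (Y : augmented A')
    (u : Hom A A') (f : precubical_mor X Y) :=
  u ∘ aug X = aug Y ∘ f 0%N.

End CategoryNotions.

Arguments precubical_mor {C} X Y.
Arguments face {C} X {n} a i : rename.
Arguments resolution {C} P A.

(* Degreewise application of a functor. *)
Program Definition precub_map (C D : category) (T : functor C D) :
    functor (precub C) (precub D) :=
  @Functor (precub C) (precub D)
    (fun X => @Precubical D (fun n => T (X n)) (fun n a i => fmor T (face X a i)) _)
    (fun X Y f => @PrecubicalMor D _ _ (fun n => fmor T (f n)) _) _ _.
Next Obligation.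
by move=> C D T X n w a i j ij; rewrite -!fmorM faceE.
Qed.
Next Obligation.
by move=> C D T X Y f n a i /=; rewrite -!fmorM pmor_face.
Qed.
Next Obligation.
by move=> *; apply: precubical_mor_eq => n /=; rewrite fmor1.
Qed.
Next Obligation.
by move=> *; apply: precubical_mor_eq => n /=; rewrite fmorM.
Qed.

Program Definition precub_trans (C D : category) (S T : functor C D)
    (t : nat_trans S T) (X : precub C) :
    precubical_mor (precub_map S X) (precub_map T X) :=
  @PrecubicalMor D (precub_map S X) (precub_map T X) (fun n => t (X n)) _.
Next Obligation. by move=> C D S T t X n a i /=; rewrite ntcE. Qed.

(** * Abelian categories *)

(* A category whose hom-sets are abelian groups; bilinearity of the composition
   is required in [abelian] below. The class [GRing.Zmodule] also provides
   decidable equality and a choice operator, which exist on every type by the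
   axioms of [boolp]. *)
Record ab_category := AbCategory {
  ab_cat :> category;
  hom_zmod : forall X Y : ab_cat, GRing.Zmodule (Hom X Y)
}.
HB.instance Definition _ (B : ab_category) (X Y : B) := hom_zmod X Y.

Section Kernels.
Variable B : ab_category.

Definition is_kernel (X Y K : B) (f : Hom X Y) (k : Hom K X) :=
  f ∘ k = 0 /\
  forall D (h : Hom D X), f ∘ h = 0 -> exists! u : Hom D K, k ∘ u = h.

Definition is_cokernel (X Y Q : B) (f : Hom X Y) (q : Hom Y Q) :=
  q ∘ f = 0 /\
  forall D (h : Hom Y D), h ∘ f = 0 -> exists! u : Hom Q D, u ∘ q = h.

Definition is_biproduct (X Y S : B) (i1 : Hom X S) (i2 : Hom Y S)
    (p1 : Hom S X) (p2 : Hom S Y) :=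
  [/\ p1 ∘ i1 = idc X, p2 ∘ i2 = idc Y, p1 ∘ i2 = 0, p2 ∘ i1 = 0
    & i1 ∘ p1 + i2 ∘ p2 = idc S].
End Kernels.

Record abelian := Abelian {
  abelian_cat :> ab_category;
  compcDl : forall (X Y Z : abelian_cat) (f g : Hom Y Z) (h : Hom X Y),
    (f + g) ∘ h = f ∘ h + g ∘ h;
  compcDr : forall (X Y Z : abelian_cat) (h : Hom Y Z) (f g : Hom X Y),
    h ∘ (f + g) = h ∘ f + h ∘ g;
  zero_ex : exists Z : abelian_cat, is_initial Z /\ is_terminal Z;
  biproduct_ex : forall X Y : abelian_cat,
    exists (S : abelian_cat) (i1 : Hom X S) (i2 : Hom Y S)
           (p1 : Hom S X) (p2 : Hom S Y), is_biproduct i1 i2 p1 p2;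
  kernel_ex : forall (X Y : abelian_cat) (f : Hom X Y),
    exists (K : abelian_cat) (k : Hom K X), is_kernel f k;
  cokernel_ex : forall (X Y : abelian_cat) (f : Hom X Y),
    exists (Q : abelian_cat) (q : Hom Y Q), is_cokernel f q;
  mono_kernel : forall (K X : abelian_cat) (k : Hom K X), mono k ->
    exists (Y : abelian_cat) (f : Hom X Y), is_kernel f k;
  epi_cokernel : forall (Y Q : abelian_cat) (q : Hom Y Q), epi q ->
    exists (X : abelian_cat) (f : Hom X Y), is_cokernel f q
}.

Section Abelian.
Variable B : abelian.

Lemma compc0 (X Y Z : B) (f : Hom Y Z) : f ∘ (0 : Hom X Y) = 0.
Proof. by apply: (addrI (f ∘ 0)); rewrite -compcDr !addr0. Qed.

Lemma comp0c (X Y Z : B) (f : Hom X Y) : (0 : Hom Y Z) ∘ f = 0.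
Proof. by apply: (addrI (0 ∘ f)); rewrite -compcDl !addr0. Qed.

Lemma compcN (X Y Z : B) (f : Hom Y Z) (g : Hom X Y) : f ∘ (- g) = - (f ∘ g).
Proof. by apply: (addrI (f ∘ g)); rewrite -compcDr !subrr compc0. Qed.

Lemma compNc (X Y Z : B) (f : Hom Y Z) (g : Hom X Y) : (- f) ∘ g = - (f ∘ g).
Proof. by apply: (addrI (f ∘ g)); rewrite -compcDl !subrr comp0c. Qed.

Lemma compcBr (X Y Z : B) (h : Hom Y Z) (f g : Hom X Y) :
  h ∘ (f - g) = h ∘ f - h ∘ g.
Proof. by rewrite compcDr compcN. Qed.

Lemma compcBl (X Y Z : B) (f g : Hom Y Z) (h : Hom X Y) :
  (f - g) ∘ h = f ∘ h - g ∘ h.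
Proof. by rewrite compcDl compNc. Qed.

Lemma compcMnr (X Y Z : B) (f : Hom Y Z) (g : Hom X Y) n :
  f ∘ (g *+ n) = (f ∘ g) *+ n.
Proof. by elim: n => [|n IH]; rewrite ?compc0// !mulrS compcDr IH. Qed.

Lemma compcMnl (X Y Z : B) (f : Hom Y Z) (g : Hom X Y) n :
  (f *+ n) ∘ g = (f ∘ g) *+ n.
Proof. by elim: n => [|n IH]; rewrite ?comp0c// !mulrS compcDl IH. Qed.

Lemma compc_suml (X Y Z : B) I (s : seq I) (F : I -> Hom Y Z) (h : Hom X Y) :
  (\sum_(i <- s) F i) ∘ h = \sum_(i <- s) (F i ∘ h).
Proof. by elim: s => [|i s IH]; rewrite ?big_nil ?comp0c// !big_cons compcDl IH. Qed.

Lemma compc_sumr (X Y Z : B) I (s : seq I) (F : I -> Hom X Y) (h : Hom Y Z) :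
  h ∘ (\sum_(i <- s) F i) = \sum_(i <- s) (h ∘ F i).
Proof. by elim: s => [|i s IH]; rewrite ?big_nil ?compc0// !big_cons compcDr IH. Qed.

(* Multiplication by [(-1)^n]. *)
Definition signed (X Y : B) n (f : Hom X Y) : Hom X Y :=
  if odd n then - f else f.

Lemma compc_signed (X Y Z : B) n (f : Hom Y Z) (g : Hom X Y) :
  f ∘ signed n g = signed n (f ∘ g).
Proof. by rewrite /signed; case: odd; rewrite ?compcN. Qed.

Lemma signed_compc (X Y Z : B) n (f : Hom Y Z) (g : Hom X Y) :
  signed n f ∘ g = signed n (f ∘ g).
Proof. by rewrite /signed; case: odd; rewrite ?compNc. Qed.

Lemma signed_eq0 (X Y : B) n (f : Hom X Y) : (signed n f == 0) = (f == 0).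
Proof. by rewrite /signed; case: odd; rewrite ?oppr_eq0. Qed.

Lemma signed0 (X Y : B) n : signed n (0 : Hom X Y) = 0.
Proof. by apply/eqP; rewrite signed_eq0. Qed.

(** * Subobjects *)

Record subobject (X : B) := Subobject {
  sub_ob :> B;
  incl : Hom sub_ob X;
  incl_mono : mono incl
}.

Definition factors (X D : B) (S : subobject X) (h : Hom D X) :=
  exists u : Hom D S, incl S ∘ u = h.

Definition factor (X D : B) (S : subobject X) (h : Hom D X)
  (hS : factors S h) : Hom D S := sval (cid hS).

Lemma factorK (X D : B) (S : subobject X) (h : Hom D X) (hS : factors S h) :
  incl S ∘ factor hS = h.
Proof. exact: svalP (cid hS). Qed.

Definition whole (X : B) : subobject X.
Proof.
by exists X (idc X) => D g h; rewrite !comp1c.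
Defined.

Lemma is_kernel_mono (X Y K : B) (f : Hom X Y) (k : Hom K X) :
  is_kernel f k -> mono k.
Proof.
move=> [fk0 kU] D g h kgh.
have fkg : f ∘ (k ∘ g) = 0 by rewrite compcA fk0 comp0c.
have [u [_ uU]] := kU D _ fkg.
by rewrite -(uU g)// (uU h).
Qed.

Lemma kernel_subobject_ex (X Y : B) (f : Hom X Y) :
  exists S : subobject X, is_kernel f (incl S).
Proof.
have [K [k kP]] := kernel_ex f.
by exists (Subobject (is_kernel_mono kP)).
Qed.

Definition ker (X Y : B) (f : Hom X Y) : subobject X :=
  sval (cid (kernel_subobject_ex f)).

Lemma kerP (X Y : B) (f : Hom X Y) : is_kernel f (incl (ker f)).
Proof. exact: svalP (cid (kernel_subobject_ex f)). Qed.

Lemma factors_ker (X Y D : B) (f : Hom X Y) (h : Hom D X) :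
  factors (ker f) h <-> f ∘ h = 0.
Proof.
have [f0 fU] := kerP f; split=> [[u <-]|/fU[u [uh _]]]; last by exists u.
by rewrite compcA f0 comp0c.
Qed.

Definition sub_comp (X : B) (S : subobject X) (S' : subobject S) : subobject X.
Proof.
refine (@Subobject X (sub_ob S') (incl S ∘ incl S') _) => D g h.
by rewrite -!compcA => /(@incl_mono _ S)/(@incl_mono _ S').
Defined.

(* The intersection of the kernels of the members of [s]; note that the kernel
   of [f ∘ incl S], viewed as a subobject of [X], is the intersection of [S]
   with the kernel of [f]. *)
Fixpoint kers (X Y : B) (s : seq (Hom X Y)) : subobject X :=
  if s is f :: s' then sub_comp (ker (f ∘ incl (kers s'))) else whole X.

Lemma factors_kers (X Y D : B) (s : seq (Hom X Y)) (h : Hom D X) :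
  factors (kers s) h <-> (forall f, f \in s -> f ∘ h = 0).
Proof.
elim: s => [|f s IH] /=.
  by split=> // _; exists h; rewrite comp1c.
split=> [[u /= uh] g|h0].
  rewrite inE => /predU1P[->|gs].
    rewrite -uh !compcA.
    by have [-> _] := kerP (f ∘ incl (kers s)); rewrite comp0c.
  apply: IH.1 g gs; exists (incl (ker (f ∘ incl (kers s))) ∘ u).
  by rewrite compcA.
have [v vh] : factors (kers s) h.
  by apply: IH.2 => g gs; apply: h0; rewrite inE gs orbT.
have [w wv] : factors (ker (f ∘ incl (kers s))) v.
  by apply/factors_ker; rewrite -compcA vh h0// mem_head.
by exists w; rewrite -vh -wv compcA.
Qed.

(** * Chain complexes and homology *)

Record chain_complex := ChainComplex {
  chain_ob :> nat -> B;
  diff : forall n, Hom (chain_ob n.+1) (chain_ob n);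
  diff_diff : forall n, diff n ∘ diff n.+1 = 0
}.

Record chain_map (C D : chain_complex) := ChainMap {
  cmap :> forall n, Hom (C n) (D n);
  cmap_diff : forall n, diff D n ∘ cmap n.+1 = cmap n ∘ diff C n
}.

Lemma chain_map_eq C D (f g : chain_map C D) : (forall n, f n = g n) -> f = g.
Proof.
case: f g => [f fE] [g gE] /= fg.
have {}fg : f = g by apply: functional_extensionality_dep.
by case: _ / fg gE => gE; rewrite (Prop_irrelevance fE gE).
Qed.

Program Definition chain_id C : chain_map C C :=
  @ChainMap C C (fun n => idc (C n)) _.
Next Obligation. by move=> *; rewrite comp1c compc1. Qed.

Program Definition chain_comp C D E (g : chain_map D E) (f : chain_map C D) :
  chain_map C E := @ChainMap C E (fun n => g n ∘ f n) _.
Next Obligation.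
by move=> C D E g f n; rewrite compcA cmap_diff -!compcA cmap_diff.
Qed.

Program Definition complexes : category :=
  @Category chain_complex chain_map chain_id chain_comp _ _ _.
Next Obligation. by move=> *; apply: chain_map_eq => n /=; rewrite compcA. Qed.
Next Obligation. by move=> *; apply: chain_map_eq => n /=; rewrite comp1c. Qed.
Next Obligation. by move=> *; apply: chain_map_eq => n /=; rewrite compc1. Qed.

Definition cycles (C : chain_complex) n : subobject (C n) :=
  match n return subobject (C n) with
  | 0 => whole (C 0%N)
  | m.+1 => ker (diff C m)
  end.

Lemma diff_cycles (C : chain_complex) n : factors (cycles C n) (diff C n).
Proof.
case: n => [|n] /=; first by exists (diff C 0); rewrite comp1c.
by apply/factors_ker; rewrite diff_diff.
Qed.

Definition boundary (C : chain_complex) n : Hom (C n.+1) (cycles C n) :=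
  factor (diff_cycles C n).

Lemma cokernel_ex' (X Y : B) (f : Hom X Y) :
  exists q : {Q : B & Hom Y Q}, is_cokernel f (projT2 q).
Proof. by have [Q [q qP]] := cokernel_ex f; exists (existT _ Q q). Qed.

Definition coker (X Y : B) (f : Hom X Y) : B := projT1 (sval (cid (cokernel_ex' f))).

Definition coker_proj (X Y : B) (f : Hom X Y) : Hom Y (coker f) :=
  projT2 (sval (cid (cokernel_ex' f))).

Lemma cokerP (X Y : B) (f : Hom X Y) : is_cokernel f (coker_proj f).
Proof. exact: svalP (cid (cokernel_ex' f)). Qed.

Lemma coker_epi (X Y : B) (f : Hom X Y) : epi (coker_proj f).
Proof.
move=> D g h gh; have [f0 fU] := cokerP f.
have gf0 : (g ∘ coker_proj f) ∘ f = 0 by rewrite -compcA f0 compc0.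
have [u [_ uU]] := fU D _ gf0.
by rewrite -(uU g)// (uU h).
Qed.

Definition homology (C : chain_complex) n : B := coker (boundary C n).

Section HomologyMap.
Variables (C D : chain_complex) (f : chain_map C D) (n : nat).

Lemma cycles_map_ex : factors (cycles D n) (f n ∘ incl (cycles C n)).
Proof.
case: n => [|m] /=; first by exists (f 0%N); rewrite comp1c compc1.
apply/factors_ker; rewrite compcA cmap_diff -compcA.
by have [-> _] := kerP (diff C m); rewrite compc0.
Qed.

Definition cycles_map : Hom (cycles C n) (cycles D n) := factor cycles_map_ex.

Lemma homology_map_ex : exists u : Hom (homology C n) (homology D n),
  u ∘ coker_proj (boundary C n) = coker_proj (boundary D n) ∘ cycles_map.
Proof.
have [_ /(_ _ (coker_proj (boundary D n) ∘ cycles_map))[|u [uE _]]] :=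
  cokerP (boundary C n); last by exists u.
rewrite -compcA; have -> : cycles_map ∘ boundary C n = boundary D n ∘ f n.+1.
  apply: (@incl_mono _ (cycles D n)).
  rewrite !compcA /cycles_map factorK -compcA /boundary !factorK.
  by rewrite cmap_diff.
by rewrite compcA; have [-> _] := cokerP (boundary D n); rewrite comp0c.
Qed.

Definition homology_map : Hom (homology C n) (homology D n) :=
  sval (cid homology_map_ex).

Lemma homology_mapE : homology_map ∘ coker_proj (boundary C n) =
  coker_proj (boundary D n) ∘ cycles_map.
Proof. exact: svalP (cid homology_map_ex). Qed.
End HomologyMap.

Program Definition homology_functor n : functor complexes B :=
  @Functor complexes B (fun C => homology C n) (fun C D f => homology_map f n) _ _.
Next Obligation.
move=> n C /=; apply: (@coker_epi _ _ (boundary C n)).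
rewrite homology_mapE comp1c.
suff -> : cycles_map (idc C) n = idc (cycles C n) by rewrite compc1.
apply: (@incl_mono _ (cycles C n)).
by rewrite /cycles_map factorK comp1c compc1.
Qed.
Next Obligation.
move=> n C D E g f /=; apply: (@coker_epi _ _ (boundary C n)).
rewrite homology_mapE -[RHS]compcA homology_mapE [RHS]compcA homology_mapE.
rewrite -[RHS]compcA; congr (_ ∘ _).
apply: (@incl_mono _ (cycles E n)).
rewrite [RHS]compcA /cycles_map !factorK -[RHS]compcA factorK.
by rewrite compcA.
Qed.

(* Two chain maps which differ by boundaries on cycles agree in homology. *)
Lemma homology_map_eq (C D : chain_complex) (f g : chain_map C D) n
    (w : Hom (cycles C n) (D n.+1)) :
  diff D n ∘ w = (f n - g n) ∘ incl (cycles C n) ->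
  homology_map f n = homology_map g n.
Proof.
move=> wE; apply: (@coker_epi _ _ (boundary C n)); rewrite !homology_mapE.
have -> : cycles_map f n = cycles_map g n + boundary D n ∘ w.
  apply: (@incl_mono _ (cycles D n)).
  rewrite compcDr compcA /boundary !factorK wE compcBl.
  by rewrite addrC subrK.
rewrite compcDr compcA; have [-> _] := cokerP (boundary D n).
by rewrite comp0c addr0.
Qed.
End Abelian.

(** * The normalized complexes [N(X)] and [M(X)] *)

(* Faces indexed by natural numbers; meaningful for [k <= n]. *)
Definition nface (C : category) (X : precubical C) n (a : bool) (k : nat) :
  Hom (X n.+1) (X n) := face X a (inord k).

Lemma nfaceE (C : category) (X : precubical C) n w a k l :
  (k < l < n.+2)%N ->
  nface X n w k ∘ nface X n.+1 a l = nface X n a l.-1 ∘ nface X n.+1 w k.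
Proof.
case/andP=> kl ln; rewrite /nface.
have l0 : (0 < l)%N by apply: leq_ltn_trans kl.
have l1 : (l.-1 < n.+1)%N by rewrite -ltnS prednK.
have k1 : (k < n.+1)%N by apply: leq_trans kl _.
have -> : inord l = lift ord0 (inord l.-1 : 'I_n.+1) :> 'I_n.+2.
  by apply: val_inj => /=; rewrite /bump /= !inordK// add1n prednK.
have -> : inord k = widen_ord (leqnSn n.+1) (inord k : 'I_n.+1) :> 'I_n.+2.
  by apply: val_inj => /=; rewrite !inordK// ltnS ltnW.
by apply: faceE; rewrite !inordK// -ltnS prednK.
Qed.

Lemma alternating_sum0 (V : zmodType) (G : nat -> nat -> V) m :
  (forall i j, (i <= j < m)%N -> G i j.+1 = - G j i) ->
  \sum_(i < m) \sum_(j < m.+1) G i j = 0.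
Proof.
elim: m => [|m IH] GE; first by rewrite big_ord0.
rewrite big_ord_recr /=.
under eq_bigr do rewrite big_ord_recr /=.
rewrite big_split /= IH => [|i j /andP[ij jm]]; last first.
  by apply: GE; rewrite ij ltnW.
rewrite add0r big_ord_recr big_ord_recr /= GE ?leqnn ?ltnSn//.
under eq_bigr => i _ do rewrite (GE i m) ?(ltnW (ltn_ord i)) ?ltnSn//.
by rewrite sumrN addrA addKr subrr.
Qed.

Section Normalization.
Variable B : abelian.
Implicit Types X Y : precubical B.

Definition N_ob X n : subobject (X n) :=
  match n return subobject (X n) with
  | 0 => whole (X 0%N)
  | m.+1 => kers [seq face X true i | i <- enum 'I_m.+1]
  end.

Definition M_ob X n : subobject (X n) :=
  match n return subobject (X n) with
  | 0 => whole (X 0%N)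
  | m.+1 => kers ([seq face X true i | i <- enum 'I_m.+1] ++
                  [seq face X false (widen_ord (leqnSn m) i) | i <- enum 'I_m])
  end.

(* The differentials in degree [n + 1], to be restricted to [N_ob X n.+1] and
   [M_ob X n.+1]. The signs take the shift of the indices into account. *)
Definition N_diff X n : Hom (X n.+1) (X n) :=
  \sum_(i < n.+1) signed i (face X false i).

Definition M_diff X n : Hom (X n.+1) (X n) := signed n (face X false ord_max).

Lemma factors_whole (D Z : B) (h : Hom D Z) : factors (whole Z) h.
Proof. by exists h; rewrite comp1c. Qed.

Lemma factors_N X n D (h : Hom D (X n.+1)) :
  factors (N_ob X n.+1) h <->
  (forall k, (k < n.+1)%N -> nface X n true k ∘ h = 0).
Proof.
rewrite factors_kers; split=> [h0 k kn|h0 f /mapP[i _ ->]].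
  by apply/h0/map_f; rewrite mem_enum.
by rewrite -[i]inord_val; apply: h0.
Qed.

Lemma factors_M X n D (h : Hom D (X n.+1)) :
  factors (M_ob X n.+1) h <->
  (forall k, (k < n.+1)%N -> nface X n true k ∘ h = 0) /\
  (forall k, (k < n)%N -> nface X n false k ∘ h = 0).
Proof.
rewrite factors_kers; split=> [h0|[h1 h0] f].
  split=> k kn; apply: h0; rewrite mem_cat.
    by apply/orP; left; apply/mapP; exists (inord k); rewrite ?mem_enum.
  apply/orP; right; rewrite /nface.
  have -> : inord k = widen_ord (leqnSn n) (Ordinal kn).
    by apply: val_inj; rewrite /= inordK// ltnW.
  by apply/mapP; exists (Ordinal kn); rewrite ?mem_enum.
rewrite mem_cat => /orP[/mapP[i _ ->]|/mapP[i _ ->]].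
  by rewrite -[i]inord_val; apply: h1.
by rewrite -[widen_ord _ _]inord_val; apply: (h0 i (ltn_ord i)).
Qed.

Lemma factors_incl (Z : B) (S : subobject Z) : factors S (incl S).
Proof. by exists (idc _); rewrite compc1. Qed.

Lemma N_diffE X n : N_diff X n = \sum_(i < n.+1) signed i (nface X n false i).
Proof. by apply: eq_bigr => i _; rewrite /nface inord_val. Qed.

Lemma M_diffE X n : M_diff X n = signed n (nface X n false n).
Proof.
by rewrite /M_diff /nface; congr (signed _ (face _ _ _)); apply: val_inj;
  rewrite /= inordK.
Qed.

Lemma N_diff_sub X n : factors (N_ob X n) (N_diff X n ∘ incl (N_ob X n.+1)).
Proof.
case: n => [|n]; first exact: factors_whole.
apply/factors_N => k kn.
have N0 := (factors_N (incl (N_ob X n.+2))).1 (factors_incl _).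
rewrite N_diffE compcA compc_sumr compc_suml big1// => i _.
rewrite compc_signed signed_compc; apply/eqP; rewrite signed_eq0; apply/eqP.
have [ki|ik] := ltnP k i.
  rewrite nfaceE; last by rewrite ki (ltn_ord i).
  by rewrite -compcA N0 ?compc0// ltnW.
have ikn : (i < k.+1 < n.+2)%N by rewrite !ltnS ik.
have /= <- := nfaceE X false true ikn.
by rewrite -compcA N0 ?compc0.
Qed.

Lemma N_diff_diff X n : N_diff X n ∘ N_diff X n.+1 = 0.
Proof.
rewrite !N_diffE compc_suml.
under eq_bigr do rewrite compc_sumr.
pose G i j := signed i (nface X n false i) ∘ signed j (nface X n.+1 false j).
rewrite (@alternating_sum0 _ G)// => i j /andP[ij jn].
rewrite /G compc_signed signed_compc nfaceE ?ltnS ?ij//=.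
rewrite compc_signed signed_compc /signed /=.
by case: (odd i); case: (odd j) => //=; rewrite ?opprK.
Qed.

Lemma M_diff_sub X n : factors (M_ob X n) (M_diff X n ∘ incl (M_ob X n.+1)).
Proof.
case: n => [|n]; first exact: factors_whole.
have [M1 M0] := (factors_M (incl (M_ob X n.+2))).1 (factors_incl _).
rewrite M_diffE signed_compc.
have face0 b k : (k < n.+1)%N -> nface X n.+1 b k ∘ incl (M_ob X n.+2) = 0.
  by case: b => kn; rewrite ?M1 ?M0// ltnW.
suff dk b k : (k < n.+1)%N ->
    nface X n b k ∘ (nface X n.+1 false n.+1 ∘ incl (M_ob X n.+2)) = 0.
  by apply/factors_M; split=> k kn; rewrite compc_signed dk ?signed0// ltnW.
move=> kn; rewrite compcA nfaceE; last by rewrite kn leqnn.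
by rewrite -compcA face0 ?compc0.
Qed.

Lemma M_diff_diff X n : M_diff X n ∘ M_diff X n.+1 ∘ incl (M_ob X n.+2) = 0.
Proof.
have [_ M0] := (factors_M (incl (M_ob X n.+2))).1 (factors_incl _).
rewrite !M_diffE compc_signed !signed_compc nfaceE ?leqnn//= -compcA M0//.
by rewrite compc0 !signed0.
Qed.

Lemma nface_mor (C : category) (X Y : precubical C) (f : precubical_mor X Y) n a k :
  nface Y n a k ∘ f n.+1 = f n ∘ nface X n a k.
Proof. exact: pmor_face. Qed.

Lemma N_mor X Y (f : precubical_mor X Y) n :
  factors (N_ob Y n) (f n ∘ incl (N_ob X n)).
Proof.
case: n => [|n]; first exact: factors_whole.
have N0 := (factors_N (incl (N_ob X n.+1))).1 (factors_incl _).
by apply/factors_N => k kn; rewrite compcA nface_mor -compcA N0// compc0.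
Qed.

Lemma M_mor X Y (f : precubical_mor X Y) n :
  factors (M_ob Y n) (f n ∘ incl (M_ob X n)).
Proof.
case: n => [|n]; first exact: factors_whole.
have [M1 M0] := (factors_M (incl (M_ob X n.+1))).1 (factors_incl _).
by apply/factors_M; split=> k kn; rewrite compcA nface_mor -compcA ?M1 ?M0 ?compc0.
Qed.

Lemma N_diff_mor X Y (f : precubical_mor X Y) n :
  N_diff Y n ∘ f n.+1 = f n ∘ N_diff X n.
Proof.
rewrite compc_suml compc_sumr; apply: eq_bigr => i _.
by rewrite signed_compc compc_signed pmor_face.
Qed.

Lemma M_diff_mor X Y (f : precubical_mor X Y) n :
  M_diff Y n ∘ f n.+1 = f n ∘ M_diff X n.
Proof. by rewrite signed_compc compc_signed pmor_face. Qed.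

(* The functor defined by a natural choice of subobjects [S X n] of [X n]
   which are stable under a natural differential [d X n]. *)
Section Subcomplex.
Variables (S : forall X n, subobject (X n)) (d : forall X n, Hom (X n.+1) (X n)).
Hypothesis dS : forall X n, factors (S X n) (d X n ∘ incl (S X n.+1)).
Hypothesis dd : forall X n, d X n ∘ d X n.+1 ∘ incl (S X n.+2) = 0.
Hypothesis Smor : forall X Y (f : precubical_mor X Y) n,
  factors (S Y n) (f n ∘ incl (S X n)).
Hypothesis dmor : forall X Y (f : precubical_mor X Y) n,
  d Y n ∘ f n.+1 = f n ∘ d X n.

Program Definition subcomplex X : chain_complex B :=
  @ChainComplex B (fun n => S X n) (fun n => factor (dS X n)) _.
Next Obligation.
move=> X n; apply: (@incl_mono _ _ (S X n)).
by rewrite compcA factorK -compcA factorK compcA dd compc0.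
Qed.

Program Definition subcomplex_map X Y (f : precubical_mor X Y) :
    chain_map (subcomplex X) (subcomplex Y) :=
  @ChainMap B (subcomplex X) (subcomplex Y) (fun n => factor (Smor f n)) _.
Next Obligation.
move=> X Y f n; apply: (@incl_mono _ _ (S Y n)).
rewrite /= !compcA !factorK -!compcA !factorK.
by rewrite !compcA dmor.
Qed.

Program Definition subcomplex_functor : functor (precub B) (complexes B) :=
  @Functor (precub B) (complexes B) subcomplex subcomplex_map _ _.
Next Obligation.
move=> X; apply: chain_map_eq => n; apply: (@incl_mono _ _ (S X n)).
by rewrite /= factorK comp1c compc1.
Qed.
Next Obligation.
move=> X Y Z g f; apply: chain_map_eq => n; apply: (@incl_mono _ _ (S Z n)).
by rewrite /= compcA !factorK -!compcA factorK.
Qed.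
End Subcomplex.

Lemma N_diff_diff_incl X n :
  N_diff X n ∘ N_diff X n.+1 ∘ incl (N_ob X n.+2) = 0.
Proof. by rewrite N_diff_diff comp0c. Qed.

Definition N_functor : functor (precub B) (complexes B) :=
  subcomplex_functor N_diff_sub N_diff_diff_incl N_mor N_diff_mor.

Definition M_functor : functor (precub B) (complexes B) :=
  subcomplex_functor M_diff_sub M_diff_diff M_mor M_diff_mor.

Definition HN n : functor (precub B) B :=
  functor_comp (homology_functor B n) N_functor.

Definition HM n : functor (precub B) B :=
  functor_comp (homology_functor B n) M_functor.
End Normalization.

(** * Extensions of morphisms to resolutions, and homotopies *)

Lemma dependent_choice (T : nat -> Type) (R : forall n, T n -> T n.+1 -> Prop)
    (x : T 0%N) (y : T 1%N) : R 0%N x y ->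
  (forall n u v, R n u v -> exists w, R n.+1 v w) ->
  exists t : forall n, T n, t 0%N = x /\ forall n, R n (t n) (t n.+1).
Proof.
move=> Rxy step.
pose fix st n : {p : T n * T n.+1 | R n p.1 p.2} :=
  match n return {p : T n * T n.+1 | R n p.1 p.2} with
  | 0 => exist (fun p => R 0%N p.1 p.2) (x, y) Rxy
  | m.+1 => exist (fun p => R m.+1 p.1 p.2)
      ((sval (st m)).2, sval (cid (step m _ _ (svalP (st m)))))
      (svalP (cid (step m _ _ (svalP (st m)))))
  end.
exists (fun n => (sval (st n)).1); split=> // n.
exact: (svalP (st n)).
Qed.

Section Comparison.
Variables (A : category) (P : A -> Prop).

Section Lifting.
Variables (a : A) (Y : resolution P a).

Lemma res_lift_aug Q (x : Hom Q a) : P Q -> exists u : Hom Q (Y 0%N), aug Y ∘ u = x.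
Proof. by case: (resP Y) => _ eY _ _ PQ; apply: eY. Qed.

Lemma res_lift_kernel_pair Q (x : bool -> Hom Q (Y 0%N)) : P Q ->
  aug Y ∘ x false = aug Y ∘ x true ->
  exists u : Hom Q (Y 1%N), forall b, nface Y 0 b 0 ∘ u = x b.
Proof.
case: (resP Y) => _ _ [K [k [e [[_ kU] ke eP]]]] _ PQ xE.
have [v [[v0 v1] _]] := kU _ _ _ xE.
have [u uE] := eP _ PQ v; exists u => b.
rewrite /nface (_ : inord 0 = ord0); last by apply: val_inj; rewrite /= inordK.
by rewrite -ke -compcA uE; case: b.
Qed.

Lemma res_lift_cubical n Q (x : bool -> nat -> Hom Q (Y n.+1)) : P Q ->
  (forall w b k l, (k < l < n.+2)%N ->
     nface Y n w k ∘ x b l = nface Y n b l.-1 ∘ x w k) ->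
  exists u : Hom Q (Y n.+2), forall b k, (k < n.+2)%N ->
    nface Y n.+1 b k ∘ u = x b k.
Proof.
case: (resP Y) => _ _ _ /(_ n)[K [k [e [[_ kU] ke eP]]]] PQ xE.
have [|v [vE _]] := kU Q (fun b i => x b (nat_of_ord i)).
  move=> w b i j ij; have := xE w b i j.+1; rewrite /nface /= !inord_val.
  by apply; rewrite ltnS ij ltnS ltn_ord.
have [u uE] := eP _ PQ v; exists u => b m mn.
by rewrite /nface -ke -compcA uE vE inordK.
Qed.
End Lifting.

Variables (a a' : A) (X : resolution P a) (Y : resolution P a').

Lemma res_projective n : P (X n).
Proof. by case: (resP X). Qed.

Lemma extension_ex (u : Hom a a') :
  exists f : precubical_mor X Y, extends u f.
Proof.
have [f0 f0E] := res_lift_aug Y (u ∘ aug X) (res_projective 0).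
have [|f1 f1E] := res_lift_kernel_pair (x := fun b => f0 ∘ nface X 0 b 0) (res_projective 1).
  rewrite !compcA f0E -!compcA; congr (_ ∘ _).
  rewrite /nface (_ : inord 0 = ord0) ?augE//.
  by apply: val_inj; rewrite /= inordK.
pose R n (g : Hom (X n) (Y n)) (h : Hom (X n.+1) (Y n.+1)) :=
  forall b k, (k < n.+1)%N -> nface Y n b k ∘ h = g ∘ nface X n b k.
have [||f [fE0 fE]] := @dependent_choice _ R f0 f1.
- by move=> b [|k].
- move=> n g h gh.
  have [|l lE] := res_lift_cubical (x := fun b k => h ∘ nface X n.+1 b k)
                        (res_projective n.+2).
    move=> w b k l kl; rewrite !compcA !gh; first last.
    + by case/andP: kl => kl ln; apply: leq_trans kl _.
    + by case/andP: kl => kl ln; rewrite -ltnS prednK// (leq_ltn_trans _ kl).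
    by rewrite -!compcA nfaceE.
  by exists l => b k kn; rewrite lE.
have fF n b (i : 'I_n.+1) : face Y b i ∘ f n.+1 = f n ∘ face X b i.
  by have := fE n b i (ltn_ord i); rewrite /nface inord_val.
by exists (PrecubicalMor fF); rewrite /extends /= fE0.
Qed.

(* Homotopies between precubical morphisms; the extra direction is the first
   one if [s = false], and the last one if [s = true]. *)
Definition is_homotopy (s : bool) (g : bool -> precubical_mor X Y)
    (h : forall n, Hom (X n) (Y n.+1)) :=
  (forall n b, nface Y n b (if s then n else 0) ∘ h n = g b n) /\
  (forall n b k, (k < n.+1)%N ->
     nface Y n.+1 b (if s then k else k.+1) ∘ h n.+1 = h n ∘ nface X n b k).

Lemma homotopy_ex s (u : Hom a a') (g : bool -> precubical_mor X Y) :
  (forall b, extends u (g b)) -> exists h, is_homotopy s g h.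
Proof.
move=> gE.
pose Q n (h : Hom (X n) (Y n.+1)) :=
  forall b, nface Y n b (if s then n else 0) ∘ h = g b n.
pose R n h h' := [/\ Q n h, Q n.+1 h' & forall b k, (k < n.+1)%N ->
     nface Y n.+1 b (if s then k else k.+1) ∘ h' = h ∘ nface X n b k].
pose I n (h : Hom (X n) (Y n.+1)) := forall w b k l, (k < l < n.+1)%N ->
  nface Y n w (if s then k else k.+1) ∘ h ∘ nface X n b l =
  nface Y n b (if s then l.-1 else l) ∘ h ∘ nface X n w k.
have step n h : Q n h -> I n h -> exists h', R n h h'.
  move=> Qh Ih.
  pose x b k : Hom (X n.+1) (Y n.+1) :=
    if s then if k == n.+1 then g b n.+1 else h ∘ nface X n b k
    else if k == 0%N then g b n.+1 else h ∘ nface X n b k.-1.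
  have [|h' h'E] := res_lift_cubical (x := x) (res_projective n.+1).
    move=> w b k l /andP[kl ln]; rewrite /x.
    move: Qh Ih; rewrite /Q /I; case: (s) => Qh Ih.
      have kn : (k < n.+1)%N by apply: leq_trans kl _.
      rewrite (ltn_eqF kn); have [->/=|lNn] := eqVneq l n.+1.
        by rewrite nface_mor compcA Qh.
      have ln' : (l < n.+1)%N by rewrite ltn_neqAle lNn.
      by rewrite !compcA Ih ?kl.
    case: l kl ln => // l; rewrite ltnS => kl ln /=.
    case: k kl => [|k] kl /=; first by rewrite compcA Qh nface_mor.
    by rewrite !compcA Ih// kl.
  exists h'; split=> //.
    by move=> b; rewrite h'E /x; case: (s); rewrite ?eqxx.
  move=> b k kn; rewrite h'E /x; last by case: (s); rewrite // ltnS ltnW.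
  by case: (s); rewrite //= ltn_eqF.
have [|h0 h0E] := res_lift_kernel_pair (x := fun b => g b 0%N) (res_projective 0).
  by rewrite -[LHS](gE false) -[RHS](gE true).
have [||h1 R01] := step 0 h0; first by move=> b; case: (s).
  by move=> w b k [|l] /andP[].
have [|h [_ hE]] := dependent_choice R01.
  move=> n h h' [Qh Qh' hh']; apply: step => // w b k l /andP[kl ln].
  have l1 : (l.-1 < n.+1)%N by rewrite -ltnS prednK// (leq_ltn_trans _ kl).
  have k1 : (k < n.+1)%N by apply: leq_trans kl _.
  rewrite hh'// -compcA nfaceE ?kl// compcA -hh'//.
  by case: (s) => //; rewrite prednK// (leq_ltn_trans _ kl).
exists h; split=> n; last by case: (hE n).
by case: (hE n).
Qed.
End Comparison.

(** * Cubical left derived functors *)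

(* [HN] and [HM] are homotopy invariant. *)
Section HomotopyInvariance.
Variables (A : category) (B : abelian) (P : A -> Prop) (T : functor A B).
Variables (a a' : A) (X : resolution P a) (Y : resolution P a') (u : Hom a a').
Variable g : bool -> precubical_mor X Y.
Hypothesis gE : forall b, extends u (g b).

Let TX := precub_map T X.
Let TY := precub_map T Y.
Let Tg b : precubical_mor TX TY := fmor (precub_map T) (g b).

(* The difference between a homotopy from [g false] to [g true] and a homotopy
   from [g true] to itself. *)
Lemma homotopy_diff_ex (s : bool) :
  exists D : forall n, Hom (TX n) (TY n.+1),
  [/\ forall n, nface TY n false (if s then n else 0) ∘ D n
                  = Tg false n - Tg true n,
      forall n, nface TY n true (if s then n else 0) ∘ D n = 0
    & forall n b k, (k < n.+1)%N ->
        nface TY n.+1 b (if s then k else k.+1) ∘ D n.+1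
          = D n ∘ nface TX n b k].
Proof.
have [h [h1 h2]] := homotopy_ex s gE.
have [k [k1 k2]] := homotopy_ex s (g := fun=> g true) (fun=> gE true).
exists (fun n => fmor T (h n) - fmor T (k n)); split.
- by move=> n; rewrite compcBr -!fmorM h1 k1.
- by move=> n; rewrite compcBr -!fmorM h1 k1 subrr.
- move=> n b i iln; rewrite compcBr compcBl -!fmorM.
  by rewrite (h2 n b i iln) (k2 n b i iln).
Qed.

Let NC := subcomplex (@N_diff_sub B) (@N_diff_diff_incl B).
Let MC := subcomplex (@M_diff_sub B) (@M_diff_diff B).
Let Nz n := incl (N_ob TX n) ∘ incl (cycles (NC TX) n).
Let Mz n := incl (M_ob TX n) ∘ incl (cycles (MC TX) n).

Let Nz_true n k : (k < n.+1)%N -> nface TX n true k ∘ Nz n.+1 = 0.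
Proof.
move=> kn; rewrite compcA.
by rewrite ((factors_N (incl (N_ob TX n.+1))).1 (factors_incl _))// comp0c.
Qed.

Let Nz_diff n : N_diff TX n ∘ Nz n.+1 = 0.
Proof.
rewrite /Nz compcA -(factorK (N_diff_sub TX n)) -compcA.
by have [-> _] := kerP (diff (NC TX) n); rewrite compc0.
Qed.

Let Mz_face n b k : (k < n.+1)%N -> nface TX n b k ∘ Mz n.+1 = 0.
Proof.
have [M1 M0] := (factors_M (incl (M_ob TX n.+1))).1 (factors_incl _).
case: b => kn; first by rewrite compcA M1// comp0c.
have [->|kNn] := eqVneq k n; last first.
  by rewrite compcA M0 ?comp0c// ltn_neqAle kNn.
apply/eqP; rewrite -(signed_eq0 n) -signed_compc -M_diffE; apply/eqP.
rewrite /Mz compcA -(factorK (M_diff_sub TX n)) -compcA.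
by have [-> _] := kerP (diff (MC TX) n); rewrite compc0.
Qed.

Lemma HN_invariant n : fmor (HN B n) (Tg false) = fmor (HN B n) (Tg true).
Proof.
have [D [D0 D1 DE]] := homotopy_diff_ex false.
have zE : factors (N_ob TY n.+1) (D n ∘ Nz n).
  apply/factors_N => -[|k] kn; first by rewrite compcA D1 comp0c.
  case: n kn => // n kn.
  by rewrite compcA DE// -compcA Nz_true// compc0.
apply: (@homology_map_eq B (NC TX) (NC TY) (fmor (N_functor B) (Tg false))
  (fmor (N_functor B) (Tg true)) n (factor zE)).
apply: (@incl_mono _ _ (N_ob TY n)); rewrite /= !compcA factorK -compcA factorK.
rewrite compcBr !factorK -compcBl -[RHS]compcA.
rewrite N_diffE compc_suml big_ord_recl signed_compc compcA D0.
rewrite [X in _ + X](_ : _ = 0) ?addr0// {zE}.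
case: n => [|n]; first by rewrite big_ord0.
have := congr1 (fun x => - (D n ∘ x)) (Nz_diff n).
rewrite compc0 oppr0 N_diffE compc_suml compc_sumr -sumrN => zd.
rewrite -[RHS]zd; apply: eq_bigr => i _; rewrite lift0.
rewrite !signed_compc compc_signed compcA DE// -compcA /signed /=.
by case: odd; rewrite ?opprK.
Qed.

Lemma HM_invariant n : fmor (HM B n) (Tg false) = fmor (HM B n) (Tg true).
Proof.
have [D [D0 D1 DE]] := homotopy_diff_ex true.
have DM b k : (k < n)%N -> nface TY n b k ∘ (D n ∘ Mz n) = 0.
  by case: n => // m km; rewrite compcA DE// -compcA Mz_face// compc0.
have zE : factors (M_ob TY n.+1) (D n ∘ Mz n).
  apply/factors_M; split=> k kn; last exact: DM.
  have [->|kNn] := eqVneq k n; first by rewrite compcA D1 comp0c.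
  by rewrite DM// ltn_neqAle kNn.
apply: (@homology_map_eq B (MC TX) (MC TY) (fmor (M_functor B) (Tg false))
  (fmor (M_functor B) (Tg true)) n (signed n (factor zE))).
apply: (@incl_mono _ _ (M_ob TY n)).
rewrite /= !compcA factorK compc_signed -compcA factorK.
rewrite compcBr !factorK -compcBl -[RHS]compcA.
rewrite M_diffE signed_compc compcA D0 /signed.
by case: odd; rewrite ?opprK.
Qed.
End HomotopyInvariance.

Section DerivedFunctors.
Variables (A : category) (B : abelian) (P : A -> Prop).
Variable res : forall a : A, resolution P a.

Definition extension (a a' : A) (u : Hom a a') :
    precubical_mor (res a) (res a') :=
  sval (cid (extension_ex (res a) (res a') u)).

Lemma extensionE (a a' : A) (u : Hom a a') : extends u (extension u).
Proof. exact: svalP (cid (extension_ex (res a) (res a') u)). Qed.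

Lemma extends_id (a : A) : extends (idc a) (idc (res a : precub A)).
Proof. by rewrite /extends comp1c compc1. Qed.

Lemma extends_comp (a b c : A) (v : Hom b c) (u : Hom a b)
    (g : precubical_mor (res b) (res c)) (f : precubical_mor (res a) (res b)) :
  extends v g -> extends u f -> extends (v ∘ u) ((g : Hom (c := precub A) _ _) ∘ f).
Proof. by rewrite /extends /= => vg uf; rewrite -compcA uf compcA vg compcA. Qed.

(* The functor [a |-> H(T(res a))], for a functor [H] taking the same value on
   all the extensions of a given morphism. *)
Section Derived.
Variable H : functor (precub B) B.

Hypothesis H_invariant : forall (T : functor A B) (a a' : A) (u : Hom a a')
    (g : bool -> precubical_mor (res a) (res a')),
  (forall b, extends u (g b)) ->
  fmor H (fmor (precub_map T) (g false)) = fmor H (fmor (precub_map T) (g true)).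

Let derived_mor (T : functor A B) (a a' : A) (u : Hom a a') :
    Hom (H (precub_map T (res a))) (H (precub_map T (res a'))) :=
  fmor H (fmor (precub_map T) (extension u)).

Lemma derived_morE (T : functor A B) (a a' : A) (u : Hom a a')
    (f : precubical_mor (res a) (res a')) : extends u f ->
  derived_mor T u = fmor H (fmor (precub_map T) f).
Proof.
move=> uf; apply: (H_invariant (u := u) T
  (g := fun b => if b then f else extension u)).
by case=> //; apply: extensionE.
Qed.

Program Definition derived (T : functor A B) : functor A B :=
  @Functor A B (fun a => H (precub_map T (res a))) (@derived_mor T) _ _.
Next Obligation.
by move=> T a; rewrite (derived_morE T (extends_id a)) !fmor1.
Qed.
Next Obligation.
move=> T a b c v u.
rewrite (derived_morE T (extends_comp (extensionE v) (extensionE u))).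
by rewrite fmorM [LHS]fmorM.
Qed.

Program Definition derived_trans (S T : functor A B) (t : nat_trans S T) :
    nat_trans (derived S) (derived T) :=
  @NatTrans A B (derived S) (derived T)
    (fun a => fmor H (precub_trans t (res a) : Hom (c := precub B) _ _)) _.
Next Obligation.
move=> S T t a b u /=; rewrite /derived_mor -!fmorM; congr (fmor H _).
by apply: precubical_mor_eq => n /=; rewrite ntcE.
Qed.
End Derived.

Definition Lcube n : functor A B -> functor A B :=
  derived (fun T a a' u g gE => HN_invariant T gE n).

Definition Lcube_trans n (S T : functor A B) (t : nat_trans S T) :
    nat_trans (Lcube n S) (Lcube n T) :=
  derived_trans (fun T a a' u g gE => HN_invariant T gE n) t.

Definition Lcube_tilde n : functor A B -> functor A B :=
  derived (fun T a a' u g gE => HM_invariant T gE n).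

Definition Lcube_tilde_trans n (S T : functor A B) (t : nat_trans S T) :
    nat_trans (Lcube_tilde n S) (Lcube_tilde n T) :=
  derived_trans (fun T a a' u g gE => HM_invariant T gE n) t.

Lemma Lcube_morE n (T : functor A B) (a a' : A) (u : Hom a a')
    (f : precubical_mor (res a) (res a')) : extends u f ->
  fmor (Lcube n T) u = fmor (HN B n) (fmor (precub_map T) f).
Proof.
exact: (derived_morE (fun T a a' u g gE => HN_invariant T gE n)).
Qed.

Lemma Lcube_tilde_morE n (T : functor A B) (a a' : A) (u : Hom a a')
    (f : precubical_mor (res a) (res a')) : extends u f ->
  fmor (Lcube_tilde n T) u = fmor (HM B n) (fmor (precub_map T) f).
Proof.
exact: (derived_morE (fun T a a' u g gE => HM_invariant T gE n)).
Qed.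
End DerivedFunctors.

(* Main.v *)
(** Each projective resolution carries degeneracies [s_k] and connections [c_k]
    satisfying the cubical relations with the faces (but not among themselves):
    they are built by induction on the degree, by lifting along the maps [e_n].
    A functor [T] preserves them. On the normalized complex [N] of a precubical
    object, the faces with superscript 0 and the connections look like the faces
    and degeneracies of an augmented simplicial object, for which
    [d c_k + c_k d = (-1)^k c_k d_k] on the elements killed by the faces
    [d_0, ..., d_(k-1)]. Hence these faces can be killed one after the other, up
    to homology, by replacing [x] with [x - c_k (d_k x)], and the inclusion of
    [M] in [N] is a quasi-isomorphism. This inclusion is natural for all
    precubical morphisms, although the connections are not. *)

From mathcomp Require Import all_boot ssralg zify.
From mathcomp Require Import boolp.
Require Import Defs.

Set Implicit Arguments.
Unset Strict Implicit.
Unset Printing Implicit Defensive.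

Import GRing.Theory.
Local Open Scope ring_scope.
Local Obligation Tactic := idtac.

(** * Degeneracies and connections on a projective resolution *)

Section ResolutionOperators.
Variables (A : category) (P : A -> Prop) (a : A) (X : resolution P a).

(* A morphism [X n -> X n.-1] also for [n = 0], so that the recursion below can
   start one degree early, with no condition to check there. *)
Let pface n (b : bool) (k : nat) : Hom (X n) (X n.-1) :=
  match n with 0 => idc (X 0%N) | m.+1 => nface X m b k end.

(* [t n j] has prescribed faces [g] in the directions [j, ..., j + w]:
   degeneracies for [w = false], connections for [w = true]. *)
Lemma operator_ex (w : bool) (g : forall n, bool -> nat -> Hom (X n) (X n)) :
  aug X ∘ g 0%N false 0%N = aug X ∘ g 0%N true 0%N ->
  (forall n b c i j, (i < j)%N -> (j + w <= n.+1)%N ->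
     nface X n b i ∘ g n.+1 c j = g n c j.-1 ∘ nface X n b i) ->
  (forall n b c i j, (j + w <= i <= n)%N ->
     nface X n b i ∘ g n.+1 c j = g n c j ∘ nface X n b i) ->
  (forall n b c j, w -> (j <= n)%N ->
     nface X n b j ∘ g n.+1 c j = nface X n c j ∘ g n.+1 b j) ->
  exists t : forall n, nat -> Hom (X n) (X n.+1),
  [/\ forall n b i j, (j <= i <= j + w)%N -> (j + w <= n)%N ->
        nface X n b i ∘ t n j = g n b j,
      forall n b i j, (i < j)%N -> (j + w <= n.+1)%N ->
        nface X n.+1 b i ∘ t n.+1 j = t n j.-1 ∘ nface X n b i
    & forall n b i j, (j + w < i <= n.+1)%N ->
        nface X n.+1 b i ∘ t n.+1 j = t n j ∘ nface X n b i.-1].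
Proof.
move=> g0 glt ggt geq.
(* The index is shifted: [t n.+1] is the operator in degree [n], and [t 0] only starts the
   recursion. *)
pose T n := nat -> Hom (X n.-1) (X n).
pose R n (t : T n) (t' : T n.+1) := forall j b i, (j + w <= n)%N -> (i <= n)%N ->
  nface X n b i ∘ t' j =
    if (i < j)%N then t j.-1 ∘ pface n b i
    else if (i <= j + w)%N then g n b j else t j ∘ pface n b i.-1.
have [t0 t0E] : exists t0, nface X 0 false 0 ∘ t0 = g 0%N false 0%N /\
    nface X 0 true 0 ∘ t0 = g 0%N true 0%N.
  have [t0 t0E] := res_lift_kernel_pair (x := fun b => g 0%N b 0%N)
    (res_projective X 0) g0.
  by exists t0; rewrite !t0E.
have [||t [_ tE]] := @dependent_choice T R (fun=> idc (X 0%N)) (fun=> t0).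
- move=> j b i; rewrite !leqn0 addn_eq0 => /andP[/eqP -> /eqP ->] /eqP -> /=.
  by case: b; case: t0E.
- move=> n t t' tt'.
  pose x j b i : Hom (X n.+1) (X n.+1) :=
    if (i < j)%N then t' j.-1 ∘ nface X n b i
    else if (i <= j + w)%N then g n.+1 b j else t' j ∘ nface X n b i.-1.
  suff H j : (j + w <= n.+1)%N -> forall b c i l, (i < l < n.+2)%N ->
      nface X n b i ∘ x j c l = nface X n c l.-1 ∘ x j b i.
    have lift j : exists u, (j + w <= n.+1)%N -> forall b i, (i < n.+2)%N ->
        nface X n.+1 b i ∘ u = x j b i.
      have [jn|jn] := leqP (j + w) n.+1.
        by have [u uE] := res_lift_cubical (res_projective X n.+1) (H j jn); exists u.
      (* Beyond the range of [j] no face is prescribed and any morphism serves; the lift for index 0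
         provides one. *)
      have [|u _] := res_lift_cubical (res_projective X n.+1) (H 0%N _).
        by case: (w).
      by exists u.
    have [u uE] := choice lift.
    by exists u => j b i jn iln; rewrite uE.
  move=> jn b c i l /andP[il ln]; rewrite /x.
  have [lj|jl] := ltnP l j.
    rewrite (ltn_trans il lj) !compcA !tt'; try lia.
    rewrite !ifT; try lia.
    case: n t t' tt' x jn ln => [|n] t t' tt' x jn ln; first lia.
    by rewrite -!compcA; congr (_ ∘ _); apply: nfaceE; lia.
  have [lj|jwl] := leqP l (j + w).
    have [ij|ji] := ltnP i j; first by rewrite glt// compcA tt' 1?ifF 1?ifT//; lia.
    have -> : (i <= j + w)%N by lia.
    have -> : i = j by lia.
    have -> : l = j.+1 by lia.
    apply: geq; lia.
  have [ij|ji] := ltnP i j.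
    rewrite !compcA !tt'; try lia.
    rewrite ij !ifF; try lia.
    case: n t t' tt' x jn ln => [|n] t t' tt' x jn ln; first lia.
    by rewrite -!compcA; congr (_ ∘ _); apply: nfaceE; lia.
  have [ijw|jwi] := leqP i (j + w).
    rewrite compcA tt' ?ijw 1?ifF ?ggt//; lia.
  rewrite !compcA !tt' ?ifF; try lia.
  case: n t t' tt' x jn ln => [|n] t t' tt' x jn ln; first lia.
  by rewrite -!compcA; congr (_ ∘ _); apply: nfaceE; lia.
exists (fun n => t n.+1).
split=> [n b i j /andP[ji ij] jn|n b i j ij jn|n b i j /andP[ij jn]].
- by rewrite tE ?ij ?ifF//; lia.
- by rewrite tE ?ij//; lia.
- by rewrite tE ?ifF//; lia.
Qed.
End ResolutionOperators.

(* [c n k] is the connection in the directions [k] and [k + 1], for [k < n]. *)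
Definition are_connections (C : category) (X : precubical C)
    (c : forall n, nat -> Hom (X n) (X n.+1)) :=
  [/\ forall n i k, (k <= i <= k.+1)%N -> (k < n)%N ->
        nface X n false i ∘ c n k = idc (X n),
      forall n k, (k <= n)%N -> exists s : Hom (X n) (X n.+1),
        forall i, (k <= i <= k.+1)%N ->
        nface X n.+1 true i ∘ c n.+1 k = s ∘ nface X n true k,
      forall n b i k, (i < k <= n)%N ->
        nface X n.+1 b i ∘ c n.+1 k = c n k.-1 ∘ nface X n b i
    & forall n b i k, (k.+1 < i <= n.+1)%N ->
        nface X n.+1 b i ∘ c n.+1 k = c n k ∘ nface X n b i.-1].

(** Degeneracies are built first, because the prescribed 1-faces of the connections involve them. *)
Lemma connections_ex (A : category) (P : A -> Prop) (a : A) (X : resolution P a) :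
  exists c, @are_connections A X c.
Proof.
have [||||s [s_eq s_lt s_gt]] :=
  @operator_ex A P a X false (fun n b k => idc (X n)).
- by [].
- by move=> *; rewrite comp1c compc1.
- by move=> *; rewrite comp1c compc1.
- by [].
(* No connection exists in degree 0, where the identity is a placeholder. *)
pose g n : bool -> nat -> Hom (X n) (X n) := fun b k =>
  if n is m.+1 return Hom (X n) (X n) then
    if b then s m k ∘ nface X m true k else idc _
  else idc _.
have [||||c [c_eq c_lt c_gt]] := @operator_ex A P a X true g.
- by [].
- move=> n b [] i j ij jn /=; last by case: n jn => [|n] jn; rewrite comp1c compc1.
  case: n jn => [|n] jn; first lia.
  rewrite /= compcA s_lt; try lia.
  by rewrite -!compcA nfaceE//; lia.
- move=> n b [] i j ji /=; last by case: n ji => [|n] jn; rewrite comp1c compc1.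
  case: n ji => [|n] ji; first lia.
  rewrite /= compcA s_gt; try lia.
  by rewrite -!compcA [in RHS]nfaceE//; lia.
- by move=> n [] [] j _ jn //=; rewrite compc1 compcA s_eq ?comp1c//; lia.
exists c; split=> [n i k ki kn|n k kn|n b i k ik|n b i k ki].
- by rewrite c_eq; [case: n kn|lia|lia].
- exists (s n k) => i ki; rewrite c_eq//; lia.
- by apply: c_lt; lia.
- by apply: c_gt; lia.
Qed.

Lemma precub_map_connections (C D : category) (T : functor C D)
    (X : precubical C) c :
  @are_connections C X c ->
  @are_connections D (precub_map T X) (fun n k => fmor T (c n k)).
Proof.
move=> [c1 c2 c3 c4]; split=> [n i k ki kn|n k kn|n b i k ik|n b i k ki].
- by rewrite -fmorM c1// fmor1.
- have [s sE] := c2 n k kn; exists (fmor T s) => i ki.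
  by rewrite -!fmorM sE.
- by rewrite -!fmorM c3.
- by rewrite -!fmorM c4.
Qed.

Lemma signedK (B : abelian) (X Y : B) n : involutive (@signed B X Y n).
Proof. by move=> f; rewrite /signed; case: odd; rewrite ?opprK. Qed.

(** * The homotopies defined by connections *)

Section ConnectionHomotopy.
Variables (B : abelian) (X : precubical B).
Variable c0 : forall n, nat -> Hom (X n) (X n.+1).
Hypothesis c0P : are_connections c0.

(* Connections are meaningful for [k < n] only; with the value [0] elsewhere,
   [N_diff_connection] holds for [k = n] too. *)
Let c n k : Hom (X n) (X n.+1) := if (k < n)%N then c0 n k else 0.

Let c_diag n i k : (k <= i <= k.+1)%N -> (k <= n)%N ->
  nface X n.+1 false i ∘ c n.+1 k = idc (X n.+1).
Proof. by move=> ki kn; rewrite /c ltnS kn; case: c0P => ->. Qed.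

Let c_lt n b i k : (i < k <= n)%N ->
  nface X n.+1 b i ∘ c n.+1 k = c n k.-1 ∘ nface X n b i.
Proof.
move=> ik; rewrite /c !ifT; try lia.
by case: c0P => _ _ ->.
Qed.

Let c_gt n b i k : (k.+1 < i <= n.+1)%N ->
  nface X n.+1 b i ∘ c n.+1 k = c n k ∘ nface X n b i.-1.
Proof.
move=> ik; rewrite /c !ifT; try lia.
by case: c0P => _ _ _ ->.
Qed.

(* A filtration interpolating between [N] (for [k = 0]) and [M] (for [k = n],
   in degree [n + 1]). *)
Definition killed k n D (h : Hom D (X n.+1)) :=
  (forall i, (i <= n)%N -> nface X n true i ∘ h = 0) /\
  (forall i, (i < k)%N -> nface X n false i ∘ h = 0).

Lemma killed0 k n D : killed k (0 : Hom D (X n.+1)).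
Proof. by split=> i _; rewrite compc0. Qed.

Lemma killedD k n D (h h' : Hom D (X n.+1)) :
  killed k h -> killed k h' -> killed k (h + h').
Proof.
by move=> [h1 h0] [h1' h0']; split=> i ik; rewrite compcDr ?h1 ?h1' ?h0 ?h0' ?addr0.
Qed.

Lemma killed_signed k n D (h : Hom D (X n.+1)) m :
  killed k h -> killed k (signed m h).
Proof.
by move=> [h1 h0]; split=> i ik; rewrite compc_signed ?h1 ?h0 ?signed0.
Qed.

Lemma killedB k n D (h h' : Hom D (X n.+1)) :
  killed k h -> killed k h' -> killed k (h - h').
Proof. by move=> kh kh'; apply: killedD (killed_signed 1 kh'). Qed.

Lemma killed_comp k n D E (h : Hom D (X n.+1)) (u : Hom E D) :
  killed k h -> killed k (h ∘ u).
Proof.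
by move=> [h1 h0]; split=> i ik; rewrite compcA ?h1 ?h0 ?comp0c.
Qed.

Lemma killed_face k n D (h : Hom D (X n.+2)) j : (k <= j <= n.+1)%N ->
  killed k h -> killed k (nface X n.+1 false j ∘ h).
Proof.
move=> /andP[kj jn] [h1 h0]; split=> i ik; rewrite compcA.
  have [ij|ji] := ltnP i j.
    by rewrite nfaceE -?compcA ?h1 ?compc0//; lia.
  have /= <- := @nfaceE _ X n false true j i.+1; last lia.
  by rewrite -compcA h1// compc0.
by rewrite nfaceE -?compcA ?h0 ?compc0//; lia.
Qed.

Lemma killed_diff k n D (h : Hom D (X n.+2)) :
  killed k h -> killed k (N_diff X n.+1 ∘ h).
Proof.
move=> kh; rewrite N_diffE compc_suml.
apply: (big_ind (@killed k n D)) => [||i _]; [exact: killed0|exact: killedD|].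
rewrite signed_compc; apply: killed_signed.
have [ik|ki] := ltnP i k; last by apply: killed_face; rewrite // ki -ltnS /=.
by case: kh => _ ->; rewrite //; apply: killed0.
Qed.

(** Faces away from the directions [k] and [k.+1] pass through the connection to faces that kill
    [h]. In these two directions the 1-faces factor through the [k]-th 1-face, and nothing is asked
    of the 0-faces. *)
Lemma killed_connection k n D (h : Hom D (X n.+1)) : (k <= n)%N ->
  killed k h -> killed k (c n.+1 k ∘ h).
Proof.
move=> kn [h1 h0]; split=> i ik; rewrite compcA; last first.
  by rewrite c_lt ?ik// -compcA h0 ?compc0.
have [ltik|ki] := ltnP i k; first by rewrite c_lt ?ltik// -compcA h1 ?compc0//; lia.
have [ik1|ki1] := leqP i k.+1.
  rewrite /c ltnS kn; case: c0P => _ /(_ n k kn)[s sE] _ _.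
  by rewrite sE ?ki// -compcA h1// compc0.
by rewrite c_gt ?ki1// -compcA h1 ?compc0//; lia.
Qed.

(** On the left, the terms below [k] vanish, and those of index [k] and [k.+1] are [h] with opposite
    signs. The later ones match, after a shift, those of [N_diff X n ∘ h] beyond its [k]-th term,
    which is left over. *)
Lemma N_diff_connection k n D (h : Hom D (X n.+1)) : (k <= n)%N ->
  killed k h ->
  N_diff X n.+1 ∘ (c n.+1 k ∘ h) =
  signed k (c n k ∘ (nface X n false k ∘ h)) - c n k ∘ (N_diff X n ∘ h).
Proof.
move=> kn [h1 h0].
pose F i := signed i (nface X n.+1 false i ∘ (c n.+1 k ∘ h)).
pose G i := signed i (c n k ∘ (nface X n false i ∘ h)).
have -> : N_diff X n.+1 ∘ (c n.+1 k ∘ h) = \sum_(0 <= i < n.+2) F i.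
  rewrite N_diffE compc_suml big_mkord; apply: eq_bigr => i _.
  exact: signed_compc.
have -> : c n k ∘ (N_diff X n ∘ h) = \sum_(0 <= i < n.+1) G i.
  rewrite N_diffE compc_suml compc_sumr big_mkord; apply: eq_bigr => i _.
  by rewrite signed_compc compc_signed.
rewrite (big_cat_nat (n := k)) /=; [|lia|lia].
rewrite [X in X + _](_ : _ = 0) ?add0r; last first.
  rewrite big_nat big1// => i /andP[_ ik].
  by rewrite /F compcA c_lt ?ik// -compcA h0 ?compc0 ?signed0.
rewrite big_ltn; last lia.
rewrite big_ltn; last lia.
rewrite addrA.
have -> : F k + F k.+1 = 0.
  rewrite /F !compcA !c_diag ?comp1c ?leqnn ?leqnSn//.
  by rewrite /signed /=; case: odd; rewrite /= ?subrr ?addNr.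
rewrite add0r [in RHS](big_cat_nat (n := k)) /=; [|lia|lia].
rewrite [X in _ - (X + _)](_ : _ = 0) ?add0r; last first.
  rewrite big_nat big1// => i /andP[_ ik].
  by rewrite /G h0 ?compc0 ?signed0.
rewrite [in RHS]big_ltn; last lia.
rewrite opprD addrA subrr add0r big_add1 /= -sumrN big_nat [RHS]big_nat.
apply: eq_bigr => i /andP[ki ik].
rewrite /F /G compcA c_gt; last lia.
by rewrite -compcA /signed /=; case: odd; rewrite ?opprK.
Qed.

(** By [N_diff_connection], the map [x] to [c_k (d_k x)] is up to sign [d c_k + c_k d], which
    commutes with [d] since [d d = 0]. *)
Lemma N_diff_connection_face k n D (h : Hom D (X n.+2)) : (k <= n)%N ->
  killed k h ->
  N_diff X n.+1 ∘ (c n.+1 k ∘ (nface X n.+1 false k ∘ h)) =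
  c n k ∘ (nface X n false k ∘ (N_diff X n.+1 ∘ h)).
Proof.
move=> kn kh; apply: (inv_inj (@signedK _ _ _ k)).
have := N_diff_connection (leqW kn) kh.
move/(congr1 (compc (N_diff X n.+1))).
rewrite compcA N_diff_diff comp0c compcBr compc_signed => /esym/subr0_eq ->.
rewrite N_diff_connection//; last exact: killed_diff.
by rewrite [N_diff X n ∘ _]compcA N_diff_diff comp0c compc0 subr0.
Qed.

Lemma killed_succ k n D (h : Hom D (X n.+1)) : (k < n)%N -> killed k h ->
  killed k.+1 (h - c n k ∘ (nface X n false k ∘ h)).
Proof.
case: n h => // n h kn kh.
have [h1 h0] : killed k (h - c n.+1 k ∘ (nface X n.+1 false k ∘ h)).
  apply: killedB => //; apply: killed_connection => //.
  by apply: killed_face => //; lia.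
split=> // i; rewrite ltnS leq_eqVlt => /predU1P[->|]; last exact: h0.
by rewrite compcBr compcA c_diag ?leqnn ?leqnSn// comp1c subrr.
Qed.

(** On a cycle [z'], [N_diff_connection] makes [c_k (d_k z')] a boundary up to sign; subtracting it
    kills one more face. *)
Lemma killed_homologous n k D (z : Hom D (X n.+1)) : (k <= n)%N ->
  killed 0 z -> N_diff X n ∘ z = 0 ->
  exists w : Hom D (X n.+2), killed 0 w /\ killed k (z - N_diff X n.+1 ∘ w).
Proof.
move=> + z1 dz; elim: k => [_|k IH kn].
  by exists 0; rewrite compc0 subr0; split=> //; apply: killed0.
have [w [w1 kw]] := IH (ltnW kn).
set z' := z - _ in kw.
have dz' : N_diff X n ∘ z' = 0.
  by rewrite /z' compcBr dz compcA N_diff_diff comp0c subrr.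
exists (w + signed k (c n.+1 k ∘ z')); split.
  apply: killedD => //; apply: killed_signed.
  by have [? _] := killed_connection (ltnW kn) kw; split.
rewrite compcDr opprD addrA compc_signed N_diff_connection//; last exact: ltnW.
by rewrite dz' compc0 subr0 signedK; apply: killed_succ.
Qed.

(** Replacing [y] with [y - c_k (d_k y)] changes its boundary by [c_k (d_k z)], which vanishes. *)
Lemma killed_bounding n D (z : Hom D (X n.+1)) (y : Hom D (X n.+2)) :
  killed n z -> killed 0 y -> N_diff X n.+1 ∘ y = z ->
  exists y', killed n.+1 y' /\ N_diff X n.+1 ∘ y' = z.
Proof.
move=> [_ z0] y1 yz.
suff H k : (k <= n.+1)%N ->
  exists y' : Hom D (X n.+2), killed k y' /\ N_diff X n.+1 ∘ y' = z by exact: H.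
elim: k => [_|k IH kn]; first by exists y.
have [y' [ky' yz']] := IH (ltnW kn).
exists (y' - c n.+1 k ∘ (nface X n.+1 false k ∘ y')); split.
  exact: killed_succ.
rewrite compcBr N_diff_connection_face// yz'.
(* For [k = n] the face of [z] may be nonzero, but [c n n] is [0] by convention. *)
have [kltn|] := ltnP k n; first by rewrite z0// compc0 subr0.
by rewrite /c ltnNge => ->; rewrite comp0c subr0.
Qed.
End ConnectionHomotopy.

(** * The inclusion of [M] in [N] *)

(** The hypotheses are surjectivity, witnessed by [v] on the universal cycle, and injectivity on
    generalized elements; [v] induces the inverse. *)
Lemma homology_map_iso (B : abelian) (C D : chain_complex B) (f : chain_map C D) n
    (v : Hom (cycles D n) (cycles C n)) (w : Hom (cycles D n) (D n.+1)) :
  cycles_map f n ∘ v = idc _ - boundary D n ∘ w ->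
  (forall E (z : Hom E (cycles C n)) (y : Hom E (D n.+1)),
     cycles_map f n ∘ z = boundary D n ∘ y ->
     exists y', boundary C n ∘ y' = z) ->
  is_iso (homology_map f n).
Proof.
move=> vE bnd.
have [pC0 _] := cokerP (boundary C n).
have [pD0 pDU] := cokerP (boundary D n).
have [|g [gE _]] := pDU _ (coker_proj (boundary C n) ∘ v).
  (* Injectivity shows that [v] sends boundaries to boundaries. *)
  have [|y' yE] := bnd _ (v ∘ boundary D n) (idc _ - w ∘ boundary D n).
    by rewrite compcA vE compcBl compcBr comp1c compc1 compcA.
  by rewrite -compcA -yE compcA pC0 comp0c.
exists g; split.
  apply: (@coker_epi _ _ _ (boundary C n)).
  rewrite -compcA homology_mapE compcA gE comp1c.
  have [|y' yE] := bnd _ (v ∘ cycles_map f n - idc _) (- (w ∘ cycles_map f n)).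
    rewrite compcBr compcA vE compcBl comp1c compc1 compcN -compcA.
    by rewrite addrAC subrr add0r.
  rewrite -compcA -[v ∘ _](subrK (idc _)) compcDr -yE compcA pC0.
  by rewrite comp0c add0r compc1.
apply: (@coker_epi _ _ _ (boundary D n)).
rewrite -compcA gE compcA homology_mapE -compcA vE compcBr compc1 compcA pD0.
by rewrite comp0c subr0 comp1c.
Qed.

Lemma nat_trans_inverse (C D : category) (F G : functor C D)
    (t : nat_trans F G) X Y (f : Hom X Y)
    (g : Hom (G Y) (F Y)) (h : Hom (G X) (F X)) :
  g ∘ t Y = idc _ -> t X ∘ h = idc _ -> g ∘ fmor G f = fmor F f ∘ h.
Proof.
move=> gK hK; rewrite -[fmor G f]compc1 -hK (compcA (fmor _ _)) -ntcE.
by rewrite !compcA gK comp1c.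
Qed.

Section Inclusion.
Variable B : abelian.
Implicit Types X Y : precubical B.

Lemma killed_N X n D (h : Hom D (X n.+1)) :
  factors (N_ob X n.+1) h <-> killed 0 h.
Proof. by rewrite factors_N; split=> [|[]]. Qed.

Lemma killed_M X n D (h : Hom D (X n.+1)) :
  factors (M_ob X n.+1) h <-> killed n h.
Proof. exact: factors_M. Qed.

Lemma N_diff_M X n D (h : Hom D (X n.+1)) :
  factors (M_ob X n.+1) h -> N_diff X n ∘ h = M_diff X n ∘ h.
Proof.
move=> /factors_M[_ h0]; rewrite N_diffE M_diffE big_ord_recr compcDl /=.
rewrite compc_suml big1 ?add0r// => i _.
by rewrite signed_compc h0 ?signed0.
Qed.

Lemma M_sub_N X n : factors (N_ob X n) (incl (M_ob X n)).
Proof.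
case: n => [|n]; first exact: factors_whole.
by apply/factors_N; have /factors_M[] := factors_incl (M_ob X n.+1).
Qed.

Program Definition MN_map X : chain_map (M_functor B X) (N_functor B X) :=
  @ChainMap B (M_functor B X) (N_functor B X) (fun n => factor (M_sub_N X n)) _.
Next Obligation.
move=> X n; apply: (@incl_mono _ _ (N_ob X n)).
rewrite /= !compcA !factorK -!compcA !factorK.
by rewrite N_diff_M//; apply: factors_incl.
Qed.

Program Definition MN_trans : nat_trans (M_functor B) (N_functor B) :=
  @NatTrans _ _ (M_functor B) (N_functor B) MN_map _.
Next Obligation.
move=> X Y f; apply: chain_map_eq => n; apply: (@incl_mono _ _ (N_ob Y n)).
by rewrite /= !compcA !factorK -!compcA !factorK.
Qed.

Program Definition HMN n : nat_trans (HM B n) (HN B n) :=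
  @NatTrans _ _ (HM B n) (HN B n)
    (fun X => fmor (homology_functor B n) (MN_trans X)) _.
Next Obligation.
move=> n X Y f; have := ntcE MN_trans f.
by move/(congr1 (fmor (homology_functor B n))); rewrite !fmorM.
Qed.

(** Cycles are viewed inside [X n] through monomorphisms, so that equations between them can be
    checked there. *)
Let Nz X n := incl (N_ob X n) ∘ incl (cycles (N_functor B X) n).
Let Mz X n := incl (M_ob X n) ∘ incl (cycles (M_functor B X) n).

Let Nz_mono X n : mono (Nz X n).
Proof. by move=> D g h; rewrite -!compcA => /incl_mono/incl_mono. Qed.

Let Mz_mono X n : mono (Mz X n).
Proof. by move=> D g h; rewrite -!compcA => /incl_mono/incl_mono. Qed.

Let Nz_cycles_map X n : Nz X n ∘ cycles_map (MN_map X) n = Mz X n.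
Proof. by rewrite -compcA factorK compcA factorK. Qed.

Let Nz_boundary X n :
  Nz X n ∘ boundary (N_functor B X) n = N_diff X n ∘ incl (N_ob X n.+1).
Proof. by rewrite -compcA !factorK. Qed.

Let Mz_boundary X n :
  Mz X n ∘ boundary (M_functor B X) n = M_diff X n ∘ incl (M_ob X n.+1).
Proof. by rewrite -compcA !factorK. Qed.

Let N_diff_Nz X n : N_diff X n ∘ Nz X n.+1 = 0.
Proof.
rewrite /Nz compcA -(factorK (N_diff_sub X n)) -compcA.
by have [-> _] := kerP (diff (N_functor B X) n); rewrite compc0.
Qed.

Let Mz_lift X n D (h : Hom D (X n.+1)) :
  factors (M_ob X n.+1) h -> N_diff X n ∘ h = 0 -> exists v, Mz X n.+1 ∘ v = h.
Proof.
move=> hM dh; have [v vE] : factors (cycles (M_functor B X) n.+1) (factor hM).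
  apply/factors_ker/(@incl_mono _ _ (M_ob X n)).
  by rewrite compcA factorK -compcA factorK compc0 -N_diff_M.
by exists v; rewrite -compcA vE factorK.
Qed.

Lemma HMN_iso n X c : @are_connections B X c -> is_iso (HMN n X).
Proof.
move=> cP.
have [w [v [wN vE]]] : exists w v,
    factors (N_ob X n.+1) w /\ Mz X n ∘ v = Nz X n - N_diff X n ∘ w.
  case: n => [|n].
    (* In degree 0 all of [X 0] consists of cycles for both complexes. *)
    exists 0, (idc _); split; first by exists 0; rewrite compc0.
    by rewrite compc0 subr0 compc1.
  have z1 : killed 0 (Nz X n.+1) by apply: killed_comp; apply/killed_N/factors_incl.
  have [w [w1 wz]] := killed_homologous cP (leqnn n) z1 (N_diff_Nz X n).
  have [||v vE] := @Mz_lift X n _ (Nz X n.+1 - N_diff X n.+1 ∘ w).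
  - exact/killed_M.
  - by rewrite compcBr N_diff_Nz compcA N_diff_diff comp0c subrr.
  - by exists w, v; split; first exact/killed_N.
apply: (@homology_map_iso B _ _ (MN_map X) n v (factor wN)).
  apply: (@Nz_mono X n); rewrite compcA Nz_cycles_map vE compcBr compc1.
  by rewrite [in RHS]compcA Nz_boundary -compcA factorK.
move=> E u y /(congr1 (compc (Nz X n))).
rewrite !compcA Nz_cycles_map Nz_boundary -[RHS]compcA => uy.
have yN : factors (N_ob X n.+1) (incl (N_ob X n.+1) ∘ y) by exists y.
have [y' [yM yE]] : exists y', factors (M_ob X n.+1) y' /\
    N_diff X n ∘ y' = Mz X n ∘ u.
  clear v w wN vE; case: n u y uy yN => [|n] u y uy yN.
    (* In degree 1 both complexes impose the same conditions. *)
    exists (incl (N_ob X 1) ∘ y); split=> //.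
    by apply/killed_M/killed_N.
  have zM : killed n (Mz X n.+1 ∘ u).
    by do 2!apply: killed_comp; apply/killed_M/factors_incl.
  have [y' [yM yE]] := killed_bounding cP zM ((killed_N _).1 yN) (esym uy).
  by exists y'; split=> //; apply/killed_M.
exists (factor yM); apply: (@Mz_mono X n).
by rewrite compcA Mz_boundary -compcA factorK -N_diff_M.
Qed.
End Inclusion.

(** * Comparison of the two derived functors *)

Theorem mainTheorem7 (A : category) (B : abelian) (P : A -> Prop)
    (A_lim : has_finite_limits A) (P_proj : projective_class P)
    (res : forall a : A, resolution P a) (n : nat) :
  exists theta : forall T : functor A B,
      nat_trans (Lcube res n T) (Lcube_tilde res n T),
    (forall (T : functor A B) (a : A), is_iso (theta T a)) /\
    (forall (S T : functor A B) (t : nat_trans S T) (a : A),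
       theta T a ∘ Lcube_trans res n t a =
       Lcube_tilde_trans res n t a ∘ theta S a).
Proof.
have iso T a : {g : Hom (HN B n (precub_map T (res a))) (HM B n (precub_map T (res a))) |
    g ∘ HMN B n (precub_map T (res a)) = idc _ /\
    HMN B n (precub_map T (res a)) ∘ g = idc _}.
  apply: cid; have [c cP] := connections_ex (res a).
  exact: HMN_iso (precub_map_connections T cP).
(* Allowing [S] and [T] to differ covers both naturalities: [f] is the image of an extension for the
   one in [a], and the map induced by [t] for the one in the functor. *)
have inv_natural S T a b (f : Hom (precub_map S (res a)) (precub_map T (res b))) :
    sval (iso T b) ∘ fmor (HN B n) f = fmor (HM B n) f ∘ sval (iso S a).
  have [gK _] := svalP (iso T b); have [_ hK] := svalP (iso S a).
  exact: nat_trans_inverse gK hK.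
exists (fun T => @NatTrans A B (Lcube res n T) (Lcube_tilde res n T)
  (fun a => sval (iso T a)) (fun a b u => inv_natural T T a b _)).
split=> [T a|S T t a]; last exact: inv_natural.
by have [gK hK] := svalP (iso T a); exists (HMN B n (precub_map T (res a))).
Qed.
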